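(* Let $r\geq 3$, $\ell\geq 4$ and $k\geq 0$ be integers. Then for all sufficiently large $n$ (in terms of $r,\ell,k$), $$\binom{n}{r}-\binom{n-k}{r}+\mathrm{ex}_r(n-k,\{P_\ell^r,S_\ell^r\})\leq \mathrm{ex}_r(n,P_\ell^r\cup kS_\ell^r)\leq \binom{n}{r}-\binom{n-k}{r}+\mathrm{ex}_r(n-k,P_\ell^r).$$
   Context: An $r$-graph ($r$-uniform hypergraph) $H=(V(H),E(H))$ is a finite vertex set together with a set of $r$-element subsets of it (edges). The $r$-uniform linear path $P_\ell^r$ of length $\ell$ is the $r$-graph with edges $e_1,\dots,e_\ell$ such that $|e_i\cap e_j|=1$ if $|i-j|=1$ and $e_i\cap e_j=\emptyset$ for all other $i\neq j$ (with no vertices outside these edges). The $r$-uniform linear star $S_\ell^r$ is the $r$-graph with $\ell$ edges obtained from the graph star with $\ell$ edges by inserting $r-2$ new distinct vertices in each edge (so all $\ell$ edges share one common vertex and are otherwise pairwise disjoint). $H\cup G$ denotes disjoint union and $kH$ the disjoint union of $k$ copies of $H$. For a family $\mathcal{F}$ of $r$-graphs, an $r$-graph is $\mathcal{F}$-free if it contains no member of $\mathcal{F}$ as a (not necessarily induced) subgraph; the Turán number $\mathrm{ex}_r(n,\mathcal{F})$ is the maximum number of edges in an $\mathcal{F}$-free $r$-graph on $n$ vertices, and $\mathrm{ex}_r(n,F)=\mathrm{ex}_r(n,\{F\})$. Host hypergraphs here are not required to be linear. *)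

(* Defs.v *)
From mathcomp Require Import all_boot.
From mathcomp Require Import zify.

Set Implicit Arguments.
Unset Strict Implicit.
Unset Printing Implicit Defensive.

Record hypergraph := Hypergraph {
  vertex :> finType;
  edges : {set {set vertex}}
}.

Definition uniform (r : nat) (H : hypergraph) : bool :=
  [forall e in edges H, #|e| == r].

(* [H] contains [G] as a not necessarily induced subgraph. *)
Definition contains (H G : hypergraph) : bool :=
  [exists f : {ffun G -> H},
     injectiveb f && [forall e in edges G, f @: e \in edges H]].

Definition free (F : seq hypergraph) (H : hypergraph) : bool :=
  all (fun G => ~~ contains H G) F.

Definition ex (r n : nat) (F : seq hypergraph) : nat :=
  \max_(E : {set {set 'I_n}} |
          uniform r (Hypergraph E) && free F (Hypergraph E)) #|E|.

(* The vertices of the path are numbered 0, ..., l(r-1) along it; edge number i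
   is the block of r consecutive vertices from i(r-1) to (i+1)(r-1), so that
   consecutive edges share exactly one endpoint. *)
Definition path_edge (r l : nat) (i : 'I_l) : {set 'I_(l * r.-1).+1} :=
  [set v : 'I_(l * r.-1).+1 | i * r.-1 <= v <= i.+1 * r.-1].

Definition linear_path (r l : nat) : hypergraph :=
  Hypergraph [set path_edge r i | i : 'I_l].

(* [inl None] is the centre and [inl (Some i)] the i-th leaf of the graph star;
   [inr (i, _)] are the r-2 new vertices inserted in its i-th edge. *)
Definition star_edge (r l : nat) (i : 'I_l) :
    {set option 'I_l + 'I_l * 'I_(r - 2)} :=
  [set inl None; inl (Some i)] :|: [set inr (i, j) | j : 'I_(r - 2)].

Definition linear_star (r l : nat) : hypergraph :=
  Hypergraph [set star_edge r i | i : 'I_l].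

Definition disjoint_union (G H : hypergraph) : hypergraph :=
  @Hypergraph (G + H)%type
    ([set inl @: e | e : {set G} in edges G]
     :|: [set inr @: e | e : {set H} in edges H]).

Definition copies (k : nat) (H : hypergraph) : hypergraph :=
  @Hypergraph ('I_k * H)%type
    [set pair i @: e | i : 'I_k, e : {set H} in edges H].

Lemma card_path_edge r l (i : 'I_l) : 0 < r -> #|path_edge r i| = r.
Proof.
move=> r0; have il := ltn_ord i.
have b (j : 'I_r) : i * r.-1 + j < (l * r.-1).+1.
  by have := ltn_ord j; nia.
have inj : injective (fun j : 'I_r => Ordinal (b j)).
  by move=> j j' /(congr1 val) /= /addnI /val_inj.
rewrite -[RHS]card_ord -(card_imset _ inj); apply: eq_card => v.
rewrite inE; apply/idP/imsetP => [/andP[h1 h2]|[j _ ->] /=].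
  have h : v - i * r.-1 < r by lia.
  by exists (Ordinal h) => //; apply: val_inj => /=; rewrite subnKC.
by have := ltn_ord j; lia.
Qed.

Lemma path_edgeI_next r l (i j : 'I_l) :
  1 < r -> j = i.+1 :> nat -> #|path_edge r i :&: path_edge r j| = 1.
Proof.
move=> r1 ji; have jl := ltn_ord j.
have b : j * r.-1 < (l * r.-1).+1 by nia.
rewrite -(cards1 (Ordinal b)); congr #|pred_of_set _|; apply/setP => v.
rewrite !inE -val_eqE /= ji; nia.
Qed.

Lemma path_edgeI_far r l (i j : 'I_l) :
  1 < r -> i.+1 < j -> path_edge r i :&: path_edge r j = set0.
Proof. by move=> r1 ij; apply/setP => v; rewrite !inE; nia. Qed.

Lemma cover_linear_path r l :
  0 < l -> 1 < r -> cover (edges (linear_path r l)) = setT.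
Proof.
move=> l0 r1; apply/setP => v; rewrite [RHS]inE; apply/bigcupP.
have vl : v <= l * r.-1 by have := ltn_ord v; rewrite ltnS.
have b : minn (v %/ r.-1) l.-1 < l by lia.
exists (path_edge r (Ordinal b)); first exact: imset_f.
have := divn_eq v r.-1; have := @ltn_pmod v r.-1.
by rewrite inE /=; nia.
Qed.

Lemma card_star_edge r l (i : 'I_l) : 1 < r -> #|star_edge r i| = r.
Proof.
move=> r1; rewrite /star_edge cardsU cards2 card_imset; last by move=> ? ? [].
rewrite card_ord /= [X in #|pred_of_set X|](_ : _ = set0) ?cards0; first lia.
apply/setP => v; rewrite !inE; apply/negbTE/negP => /andP[h /imsetP[j _ ?]].
by subst v.
Qed.

Lemma star_edgeI r l (i j : 'I_l) :
  i != j -> star_edge r i :&: star_edge r j = [set inl None].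
Proof.
move=> ij; apply/setP => -[[a|]|[a b]]; rewrite !inE //=.
- rewrite !(inj_eq inl_inj) !(inj_eq Some_inj) /=.
  have h (c : 'I_l) :
      (inl (Some a) : option 'I_l + 'I_l * 'I_(r - 2))
        \in [set inr (c, x) | x : 'I_(r - 2)] = false.
    by apply/imsetP => -[].
  rewrite !h !orbF; apply/negbTE/negP => /andP[/eqP ? /eqP ?].
  by subst; rewrite eqxx in ij.
- apply/negbTE/negP => /andP[/imsetP[? _ [? _]] /imsetP[? _ [? _]]].
  by subst; rewrite eqxx in ij.
Qed.

(* Main.v *)
Require Import Defs.
From mathcomp Require Import all_boot.
From mathcomp Require Import zify.

(** Lower bound. Let K be a set of k vertices of [n]; take every r-set that meets
K and, on the other n - k vertices, an extremal hypergraph free of the path and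
of the star. In a copy of the disjoint union of the path and k stars, each of the
k + 1 components would have to use a vertex of K, as otherwise it would lie in
the extremal part ([free_copies]); but K has only k vertices.

Upper bound. The heart is the inequality [ex_add_star]: for an arbitrary
hypergraph G, adding one disjoint star S of l edges to the forbidden
configuration costs at most one full vertex,
  ex_r(n+1, G u S) <= C(n, r-1) + ex_r(n, G)   for n large.
Iterating it k times from G = the path, Pascal's rule turns the sum of the
binomials into C(n, r) - C(n-k, r).

For the inequality, let H be (G u S)-free. Call a vertex v rich if, for every
set W of at most |V(G)| vertices not containing v, there is a copy of S centred
at v that avoids W. If v is rich, then H - v is G-free, because a copy of G in
H - v would extend by a star centred at v; and v lies in at most C(n, r-1)
edges. If no vertex is rich, a maximal partial star at v shows that the edges at
v are all met by a set T(v) of bounded size with v not in T(v)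
([petals_or_cover]). Then H has only O(n^(r-2)) edges
([card_bounded_link_covers]): every vertex of an edge e points, through T, to
another vertex of e, and since |e| >= 3 this determines two vertices of e, up to
boundedly many choices, from the r - 2 others. For n large this is below
C(n, r-1). *)

Set Implicit Arguments.
Unset Strict Implicit.
Unset Printing Implicit Defensive.

(** * Containment and extremal numbers *)

Lemma containsP (H G : hypergraph) :
  reflect (exists f : G -> H,
             injective f /\ forall e, e \in edges G -> f @: e \in edges H)
          (contains H G).
Proof.
apply: (iffP existsP) => [[f /andP[/injectiveP fI /forall_inP fE]]|[f [fI fE]]].
  by exists f.
have fE' (A : {set G}) : [ffun x => f x] @: A = f @: A.
  by apply: eq_imset => x; rewrite ffunE.
exists [ffun x => f x]; apply/andP; split.
  by apply/injectiveP => x y; rewrite !ffunE => /fI.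
by apply/forall_inP => e eG; rewrite fE' fE.
Qed.

Lemma contains_trans (H G F : hypergraph) :
  contains H G -> contains G F -> contains H F.
Proof.
move=> /containsP[f [fI fE]] /containsP[g [gI gE]].
apply/containsP; exists (f \o g); split; first exact: inj_comp.
by move=> e eF; rewrite imset_comp fE ?gE.
Qed.

Lemma free1 (G H : hypergraph) : free [:: G] H = ~~ contains H G.
Proof. by rewrite /free /= andbT. Qed.

Lemma leq_ex r n F (E : {set {set 'I_n}}) :
  uniform r (Hypergraph E) -> free F (Hypergraph E) -> #|E| <= ex r n F.
Proof.
move=> uE fE; rewrite /ex.
by apply: (@leq_bigmax_cond _ _ (fun E : {set {set 'I_n}} => #|E|)); rewrite uE.
Qed.

Lemma ex_le_contains r n (F G : hypergraph) :
  contains F G -> ex r n [:: G] <= ex r n [:: F].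
Proof.
move=> FG; apply/bigmax_leqP => E /andP[uE]; rewrite free1 => fE.
apply: leq_ex => //; rewrite free1; apply: contra fE => HF.
exact: contains_trans FG.
Qed.

(** Without an edge in each forbidden hypergraph, even the empty hypergraph may
fail to be free, and the maximum over the empty family would be a spurious 0. *)
Lemma ex_attained r n (F : seq hypergraph) :
  all (fun G => edges G != set0) F ->
  exists E : {set {set 'I_n}},
    [/\ uniform r (Hypergraph E), free F (Hypergraph E) & #|E| = ex r n F].
Proof.
move=> F0.
pose P (E : {set {set 'I_n}}) := uniform r (Hypergraph E) && free F (Hypergraph E).
have [|E /andP[uE fE] exE] := @eq_bigmax_cond _ P (fun E => #|E|); last first.
  by exists E; split => //; rewrite -exE.
apply/card_gt0P; exists set0; apply/andP; split.
  by apply/forall_inP => e; rewrite inE.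
apply: sub_all F0 => G /set0Pn[e eG].
by apply/containsP => -[f [_ /(_ e eG)]]; rewrite inE.
Qed.

(** * The lower bound *)

(** The edges of [E] inside the range of [g] come from [E'], which contains
neither [G] nor [S], so each of the k + 1 components of a copy of the disjoint
union reaches the complement of that range, and in distinct points. *)
Lemma free_copies (V : finType) (E : {set {set V}}) m (g : 'I_m -> V)
    (E' : {set {set 'I_m}}) k (G S : hypergraph) :
  injective g -> #|~: (g @: setT)| <= k ->
  (forall e, e \in E -> e \subset g @: setT -> exists2 e', e' \in E' & e = g @: e') ->
  free [:: G; S] (Hypergraph E') ->
  free [:: disjoint_union G (copies k S)] (Hypergraph E).
Proof.
move=> gI Kk EE'; rewrite /free /= !andbT => /andP[fG fS].
apply/containsP => -[f [fI fE]].
(* A component whose image misses the complement of the range of [g] pulls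
   back along [g] to a copy in [E']. *)
have hit (F : hypergraph) (h : F -> V) : injective h ->
    (forall e, e \in edges F -> h @: e \in E) -> ~~ contains (Hypergraph E') F ->
    exists x, h x \in ~: (g @: setT).
  move=> hI hE /negP nF; apply/existsP; apply: contra_notT nF.
  rewrite negb_exists => /forallP hT.
  have /fin_all_exists [h' h'E] x : exists y, h x = g y.
    by move: (hT x); rewrite inE negbK => /imsetP[y _ ->]; exists y.
  have him (e : {set F}) : h @: e = g @: (h' @: e).
    by rewrite -imset_comp; apply: eq_imset.
  apply/containsP; exists h'; split => [x y xy|e eF].
    by apply: hI; rewrite !h'E xy.
  have [|e' e'E] := EE' _ (hE _ eF); first by rewrite him imsetS ?subsetT.
  by rewrite him => /(imset_inj gI) ->.
have [x xK] : exists x, f (inl x) \in ~: (g @: setT).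
  apply: hit fG => [x y /fI[]//|e eG].
  rewrite (imset_comp f inl); apply: fE; rewrite inE; apply/orP; left.
  exact: imset_f.
have /fin_all_exists [y yK] (i : 'I_k) :
    exists y, f (inr (i, y)) \in ~: (g @: setT).
  apply: hit fS => [y z /fI[]//|e eS].
  rewrite (imset_comp (fun z => f (inr z)) (pair i)) (imset_comp f inr).
  apply: fE; rewrite inE; apply/orP; right; apply: imset_f.
  by apply/imset2P; exists i e.
pose h (o : option 'I_k) :=
  f (if o is Some i then inr (i, y i) else inl x).
have hI : injective h by move=> [i|] [j|] /fI // [->].
have : h @: setT \subset ~: (g @: setT).
  by apply/subsetP => _ /imsetP[[i|] _ ->]; rewrite /h.
move=> /subset_leq_card /leq_trans /(_ Kk).
by rewrite card_imset // cardsT card_option card_ord ltnn.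
Qed.

Lemma ex_copies_lower r n k (G S : hypergraph) :
  edges G != set0 -> edges S != set0 -> k <= n ->
  'C(n, r) - 'C(n - k, r) + ex r (n - k) [:: G; S]
    <= ex r n [:: disjoint_union G (copies k S)].
Proof.
move=> G0 S0 kn.
have [|E' [uE' fE' <-]] := @ex_attained r (n - k) [:: G; S].
  by rewrite /= G0 S0.
pose g : 'I_(n - k) -> 'I_n := widen_ord (leq_subr k n).
have gI : injective g by move=> x y /(congr1 val) /= /val_inj.
have gsI : injective (fun e : {set 'I_(n - k)} => g @: e) by exact: imset_inj.
pose A := [set e : {set 'I_n} | #|e| == r].
pose B := [set g @: e | e : {set 'I_(n - k)} in [set e : {set 'I_(n - k)} | #|e| == r]].
pose D := [set g @: e | e : {set 'I_(n - k)} in E'].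
have cardA : #|A| = 'C(n, r) by rewrite card_draws card_ord.
have cardB : #|B| = 'C(n - k, r).
  by rewrite card_imset // card_draws card_ord.
have BA : B \subset A.
  by apply/subsetP => _ /imsetP[e + ->]; rewrite !inE card_imset.
have DB : D \subset B.
  apply/subsetP => _ /imsetP[e eE ->]; apply: imset_f.
  by rewrite inE (forall_inP uE' e eE).
have dis : (A :\: B) :&: D = set0.
  apply/setP => e; rewrite !inE; apply/negP => /andP[/andP[eB _] /(subsetP DB) eB'].
  by rewrite eB' in eB.
have -> : 'C(n, r) - 'C(n - k, r) + #|E'| = #|(A :\: B) :|: D|.
  by rewrite cardsU dis cards0 subn0 cardsDS // cardA cardB card_imset.
apply: leq_ex.
  apply/forall_inP => e /setUP[/setDP[]|/(subsetP DB)/(subsetP BA)];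
    by rewrite inE.
apply: (free_copies gI _ _ fE').
  have := cardsC (g @: setT); rewrite card_imset // cardsT !card_ord; lia.
move=> e /setUP[/setDP[eA eB] eg|/imsetP[e' e'E ->] _]; last by exists e'.
have eg' : e = g @: (g @^-1: e).
  apply/setP => x; apply/idP/imsetP => [xe|[y + ->]]; last by rewrite inE.
  by have /imsetP[y _ xy] := subsetP eg x xe; exists y; rewrite // inE -xy.
case/negP: eB; rewrite eg'; apply: imset_f.
by move: eA; rewrite !inE {1}eg' card_imset.
Qed.

(** * Stars at a vertex *)

(** A linear star of [E] centred at [v], given by its set of edges rather than by
an embedding, so that one can speak of a largest one. *)
Definition petals (V : finType) (E : {set {set V}}) (v : V) (W : {set V})
    (M : {set {set V}}) : bool :=
  [forall e in M, [&& e \in E, v \in e & [disjoint e & W]]]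
  && [forall e in M, forall e' in M, (e != e') ==> (e :&: e' == [set v])].

(** If a maximal star at [v] avoiding [W] has fewer than [l] edges, then every
edge at [v] meets [W] or meets the star outside [v], else it could be added. *)
Lemma petals_or_cover (V : finType) (E : {set {set V}}) r l v (W : {set V}) :
  1 < r -> {in E, forall e : {set _}, #|e| = r} -> v \notin W ->
  (exists2 M, petals E v W M & l <= #|M|) \/
  (exists T : {set V}, [/\ v \notin T, #|T| <= #|W| + l * r &
      {in E, forall e : {set _}, v \in e -> ~~ [disjoint e & T]}]).
Proof.
move=> r1 uE vW.
have p0 : petals E v W set0.
  by apply/andP; split; apply/forall_inP => e; rewrite inE.
case: (arg_maxnP (fun M : {set {set V}} => #|M|) p0) => M pM Mmax.
have [lM|Ml] := leqP l #|M|; first by left; exists M.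
right; exists (W :|: (cover M :\ v)).
case/andP: (pM) => /forall_inP M1 /forall_inP M2.
split.
- by rewrite !inE negb_or vW eqxx.
- rewrite cardsU; apply: leq_trans (leq_subr _ _) _; rewrite leq_add2l.
  apply: leq_trans (subset_leq_card (subD1set _ _)) _.
  apply: leq_trans (leq_card_cover M) _.
  rewrite (eq_bigr (fun=> r)) => [|e /M1/and3P[/uE //]].
  by rewrite sum_nat_const leq_mul2r ltnW ?orbT.
move=> e eE ve; apply/negP => dis.
have dW : [disjoint e & W].
  by apply: disjointWr dis; apply: subsetUl.
have dM x e' : e' \in M -> x \in e -> x \in e' -> x = v.
  move=> e'M xe xe'; apply/eqP; apply: contraTT dis => xv.
  apply/pred0Pn; exists x; rewrite /= xe !inE xv /=; apply/orP; right.
  by apply/bigcupP; exists e'.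
have eM : e \notin M.
  apply/negP => eM; have : 1 < #|e| by rewrite uE.
  rewrite (cardsD1 v) ve ltnS => /card_gt0P[x]; rewrite !inE => /andP[xv xe].
  by rewrite (dM x e eM xe xe) eqxx in xv.
have eI e' : e' \in M -> e :&: e' = [set v].
  move=> e'M; apply/setP => x; rewrite !inE; apply/andP/eqP => [[]|->].
    exact: dM.
  by have /and3P[] := M1 _ e'M.
suff : petals E v W (e |: M).
  by move=> /Mmax /=; rewrite cardsU1 eM /= add1n ltnn.
apply/andP; split.
  by apply/forall_inP => e' /setU1P[->|/M1 //]; rewrite eE ve.
apply/forall_inP => a /setU1P[->|aM]; apply/forall_inP => b /setU1P[->|bM].
- by rewrite eqxx.
- by rewrite eI // eqxx implybT.
- by rewrite setIC eI // eqxx implybT.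
- exact: (forall_inP (M2 a aM)).
Qed.

(** The centre goes to [v] and the other vertices of the i-th star edge to the
successive elements of the i-th petal minus [v], the leaf coming first. *)
Lemma petals_star (V : finType) (E : {set {set V}}) r l v (W : {set V}) M :
  1 < r -> {in E, forall e : {set _}, #|e| = r} -> petals E v W M -> l <= #|M| ->
  exists f : linear_star r l -> V,
    [/\ v \notin W -> forall x, f x \notin W, injective f &
        forall e, e \in edges (linear_star r l) -> f @: e \in E].
Proof.
move=> r1 uE /andP[/forall_inP M1 /forall_inP M2] lM.
pose F (i : 'I_l) : {set V} := nth set0 (enum M) i.
have szM (i : 'I_l) : i < size (enum M).
  by rewrite -cardE (leq_trans _ lM).
have FM i : F i \in M by rewrite -mem_enum mem_nth.
have FI i j x : x != v -> x \in F i -> x \in F j -> i = j.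
  move=> xv xi xj; apply/eqP; apply: contraR xv => ij.
  have Fij : F i != F j by rewrite nth_uniq ?enum_uniq.
  rewrite -in_set1.
  by rewrite -(eqP (implyP (forall_inP (M2 _ (FM i)) _ (FM j)) Fij)) inE xi.
pose p i j := nth v (enum (F i :\ v)) j.
have szF i : size (enum (F i :\ v)) = r.-1.
  have /and3P[FE vF _] := M1 _ (FM i).
  by rewrite -cardE; have := cardsD1 v (F i); rewrite uE // vF; lia.
have pF i j : j < r.-1 -> (p i j != v) && (p i j \in F i).
  by move=> jr; rewrite -in_setD1 -mem_enum mem_nth ?szF.
have pI i i' j j' : j < r.-1 -> j' < r.-1 -> p i j = p i' j' -> i = i' /\ j = j'.
  move=> jr jr' pp; have /andP[pv pi] := pF i j jr.
  have /andP[_ pi'] := pF i' j' jr'.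
  have ii' : i = i' by apply: FI pv pi _; rewrite pp.
  subst i'; split => //; apply/eqP.
  by rewrite -(nth_uniq v _ _ (enum_uniq (F i :\ v))) ?szF //; apply/eqP.
pose f (x : linear_star r l) : V :=
  match x with
  | inl None => v
  | inl (Some i) => p i 0
  | inr (i, j) => p i j.+1
  end.
have r0 : 0 < r.-1 by lia.
have jr (j : 'I_(r - 2)) : j.+1 < r.-1 by have := ltn_ord j; lia.
have pv i j : j < r.-1 -> p i j = v -> False.
  by move=> /(pF i) /andP[/eqP].
have fI : injective f.
  move=> [[i|]|[i j]] [[i'|]|[i' j']] //=.
  - by case/pI => // ->.
  - by move/pv => [].
  - by case/pI.
  - by move/esym/pv => [].
  - by move/esym/pv => [].
  - by case/pI.
  - by move/pv => [].
  - by case/pI => // -> [/val_inj ->].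
exists f; split => //.
- move=> vW; have nW i x : x \in F i -> x \notin W.
    have /and3P[_ _ dW] := M1 _ (FM i).
    by move=> xF; rewrite (disjointFr dW xF).
  move=> [[i|]|[i j]] //=; apply: (nW i).
    by case/andP: (pF i 0 r0).
  by case/andP: (pF i j.+1 (jr j)).
- move=> _ /imsetP[i _ ->].
  have /and3P[FE vF _] := M1 _ (FM i).
  suff -> : f @: star_edge r i = F i by [].
  apply/eqP; rewrite eqEcard card_imset // card_star_edge // uE // leqnn andbT.
  apply/subsetP => _ /imsetP[x + ->]; rewrite !inE -orbA => /or3P[/eqP->|/eqP->|].
  + by [].
  + by case/andP: (pF i 0 r0).
  + by case/imsetP => j _ ->; case/andP: (pF i j.+1 (jr j)).
Qed.

(** * Few edges when every link has a bounded cover *)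

Lemma card_extensions (V : finType) (E F : {set {set V}}) c
    (T : {set V} -> {set V}) :
  (forall B, B \in F -> #|T B| <= c) ->
  (forall e, e \in E -> exists B x, [/\ B \in F, x \in T B & e = x |: B]) ->
  #|E| <= c * #|F|.
Proof.
move=> Tc EF.
have : E \subset \bigcup_(B in F) [set x |: B | x in T B].
  apply/subsetP => e /EF[B [x [BF xT ->]]]; apply/bigcupP; exists B => //.
  exact: imset_f.
move=> /subset_leq_card /leq_trans; apply.
apply: (@leq_trans (\sum_(B in F) #|[set x |: B | x in T B]|)).
  elim/big_rec2: _ => [|B s A _ IH]; first by rewrite cards0.
  by apply: leq_trans (leq_card_setU _ _) _; rewrite leq_add2l.
rewrite mulnC -sum_nat_const; apply: leq_sum => B BF.
exact: leq_trans (leq_imset_card _ _) (Tc _ BF).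
Qed.

(** Here [t] is a choice of arcs inside [e]. The point [t u] is recovered from
[u], which stays when both [t u] and [t w] are deleted from [e]; after [t u] has
been restored, [t w] is recovered from [w]. Such arcs are found on a directed
path of two arcs; if t (t u) = u instead, a third point [z] of [e] is the
source of the first arc, and the second arc lies in the 2-cycle. *)
Lemma two_dependent_points (V : finType) (e : {set V}) (t : V -> V) :
  2 < #|e| -> {in e, forall v, t v \in e} -> {in e, forall v, t v != v} ->
  exists u w, [/\ u \in e, w \in e, t u != t w, u != t w & w != t w].
Proof.
move=> e3 te tv.
have [u ue] : exists u, u \in e by apply/card_gt0P; lia.
have [uu|uu] := eqVneq (t (t u)) u; last first.
  by exists u, (t u); rewrite (eq_sym u) uu ue te // eq_sym tv ?te.
(* From here on [u] and [t u] form a 2-cycle. *)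
have [z] : exists z, z \in e :\: [set u; t u].
  apply/card_gt0P; rewrite cardsDS.
    by rewrite cards2; case: (_ != _); lia.
  by apply/subsetP => x; rewrite !inE => /orP[]/eqP->; rewrite ?te.
rewrite !inE negb_or => /andP[/andP[zu ztu] ze].
have [zt|zt] := eqVneq (t z) (t u).
  by exists z, (t u); rewrite uu ze te // zt tv // zu.
by exists z, u; rewrite ze ue zt ztu eq_sym tv.
Qed.

(** An edge arises from an (r-2)-set by adding twice a point of the union of
the [T u] over the points [u] already present; this union has at most r c points. *)
Lemma card_bounded_link_covers (V : finType) (E : {set {set V}}) r c
    (T : V -> {set V}) :
  2 < r -> {in E, forall e : {set _}, #|e| = r} ->
  (forall v, v \notin T v) -> (forall v, #|T v| <= c) ->
  (forall v, {in E, forall e : {set _}, v \in e -> ~~ [disjoint e & T v]}) ->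
  #|E| <= (r * c) * ((r * c) * 'C(#|V|, r - 2)).
Proof.
move=> r3 uE vT Tc ET.
pose U (A : {set V}) := \bigcup_(u in A) T u.
have Uc (A : {set V}) : #|A| <= r -> #|U A| <= r * c.
  move=> Ar; apply: (@leq_trans (\sum_(u in A) #|T u|)).
    rewrite /U; elim/big_rec2: _ => [|u s B _ IH]; first by rewrite cards0.
    by apply: leq_trans (leq_card_setU _ _) _; rewrite leq_add2l.
  apply: (@leq_trans (\sum_(u in A) c)); first exact: leq_sum.
  by rewrite sum_nat_const leq_mul2r Ar orbT.
pose F0 := [set A : {set V} | #|A| == r - 2].
pose F1 := [set x |: A | A in F0, x in U A].
have F1r B : B \in F1 -> #|B| <= r.
  move=> /imset2P[A x]; rewrite inE => /eqP Ar _ ->.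
  by apply: leq_trans (leq_card_setU _ _) _; rewrite cards1 Ar; lia.
apply: (@leq_trans (r * c * #|F1|)).
  apply: (@card_extensions _ _ _ _ U) => [B /F1r|e eE]; first exact: Uc.
  have /fin_all_exists [t tP] (v : V) : exists x, v \in e -> (x \in e) && (x \in T v).
    have [ve|_] := boolP (v \in e); last by exists v.
    by have /pred0Pn[x /= xP] := ET v e eE ve; exists x.
  have te : {in e, forall v, t v \in e} by move=> v /tP/andP[].
  have tT : {in e, forall v, t v \in T v} by move=> v /tP/andP[].
  have tv : {in e, forall v, t v != v}.
    by move=> v ve; apply: contraNneq (vT v) => {1}<-; apply: tT.
  have [|u [w [ue we xy uy wy]]] := two_dependent_points _ te tv.
    by rewrite uE.
  have ux := tv u ue.
  pose A := e :\ t w :\ t u.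
  have yAe : t u |: A = e :\ t w.
    by rewrite /A setD1K // !inE xy te.
  have eE' : e = t w |: (t u |: A) by rewrite yAe setD1K // te.
  exists (t u |: A), (t w); split => //.
    apply/imset2P; exists A (t u) => //.
      have c1 := cardsD1 (t w) e; have c2 := cardsD1 (t u) (e :\ t w).
      rewrite inE -/A in c2 *; move: c1 c2.
      by rewrite uE // !inE xy !te // -/A => -> c2; apply/eqP; lia.
    by apply/bigcupP; exists u; rewrite ?tT // !inE eq_sym ux uy ue.
  by apply/bigcupP; exists w; rewrite ?tT // yAe !inE wy we.
rewrite leq_mul2l; apply/orP; right.
have <- : #|F0| = 'C(#|V|, r - 2) by rewrite card_draws.
apply: (@card_extensions _ _ _ _ U) => [A|e /imset2P[A x AF xU ->]].
  by rewrite inE => /eqP Ar; apply: Uc; lia.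
by exists A, x.
Qed.

(** * Removing one star *)

(** C(n+1, r) has order n^r and C(n, r+1) has order n^(r+1). The threshold makes
C(n+1, r) <= 2 C(n, r) and 2 c (r+1) <= n - r, and C(n, r+1) = C(n, r) (n-r)/(r+1). *)
Lemma bin_order_gap c r :
  exists N, forall n, N <= n -> c * 'C(n.+1, r) <= 'C(n, r.+1).
Proof.
exists (r.+1 * (2 * c) + 2 * r) => n nN.
have h1 := mul_bin_left n r.
have h2 := mul_bin_down n.+1 r; rewrite /= in h2.
have h3 : 'C(n.+1, r) <= 2 * 'C(n, r).
  have p : 0 < n.+1 - r by lia.
  rewrite -(leq_pmul2l p) -h2; nia.
have p : 0 < r.+1 by [].
rewrite -(leq_pmul2l p) h1.
apply: (@leq_trans (r.+1 * (2 * c) * 'C(n, r))); first nia.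
by rewrite leq_mul2r; apply/orP; right; lia.
Qed.

Lemma card_delete_vertex n r (E : {set {set 'I_n.+1}}) (v : 'I_n.+1) :
  0 < r -> {in E, forall e : {set _}, #|e| = r} ->
  #|E| <= 'C(n, r.-1)
          + #|[set e : {set 'I_n} | [set lift v x | x in e] \in E]|.
Proof.
move=> r0 uE.
pose L := fun e : {set 'I_n} => [set lift v x | x in e].
have LI : injective L by apply: imset_inj; exact: lift_inj.
have Lpre (e : {set 'I_n.+1}) : v \notin e -> e = L (lift v @^-1: e).
  move=> ve; apply/setP => x; apply/idP/imsetP => [xe|[y + ->]]; last by rewrite inE.
  case: (unliftP v x) => [y xy|xv]; last by rewrite -xv xe in ve.
  by exists y; rewrite // inE -xy.
rewrite -(cardsID [set e : {set 'I_n.+1} | v \in e] E); apply: leq_add.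
  pose D := [set e : {set 'I_n} | #|e| == r.-1].
  have <- : #|D| = 'C(n, r.-1) by rewrite card_draws card_ord.
  apply: (@leq_trans #|[set v |: L e | e in D]|); last exact: leq_imset_card.
  apply: subset_leq_card; apply/subsetP => e; rewrite !inE => /andP[eE ve].
  have vD : v \notin e :\ v by rewrite !inE eqxx.
  apply/imsetP; exists (lift v @^-1: (e :\ v)); last by rewrite -Lpre // setD1K.
  rewrite inE -(card_imset _ (@lift_inj _ v)) -/(L _) -Lpre //.
  by have := cardsD1 v e; rewrite ve uE // => ->.
rewrite -(card_imset _ LI); apply: subset_leq_card; apply/subsetP => e.
rewrite !inE => /andP[ve eE]; rewrite (Lpre e ve); apply: imset_f.
by rewrite inE -/(L _) -Lpre.
Qed.

Lemma ex_add_star r l (G : hypergraph) :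
  2 < r -> exists N, forall n, N <= n ->
  ex r n.+1 [:: disjoint_union G (linear_star r l)]
    <= 'C(n, r.-1) + ex r n [:: G].
Proof.
move=> r3; pose c := #|G| + l * r.
have [N NP] := bin_order_gap ((r * c) * (r * c)) (r - 2).
exists N => n /NP gap; apply/bigmax_leqP => E /andP[/forall_inP uE']; rewrite free1.
have r1 : 1 < r by lia.
have uE : {in E, forall e : {set _}, #|e| = r} by move=> e /uE' /eqP.
pose rich v := [forall W : {set 'I_n.+1}, (#|W| <= #|G|) && (v \notin W) ==>
  [exists M, petals E v W M && (l <= #|M|)]].
move=> fE; case: (pickP rich) => [v /forallP vR|poor].
  apply: leq_trans (card_delete_vertex v (ltnW r1) uE) _; rewrite leq_add2l.
  apply: leq_ex.
    apply/forall_inP => e; rewrite inE => /uE.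
    by rewrite card_imset => [->|]; last exact: lift_inj.
  rewrite free1; apply: contra fE => /containsP[f [fI fE]].
  (* [W] is the vertex set of the copy of [G]; the star found at [v] avoids it. *)
  pose W := [set lift v (f x) | x in setT].
  have vW : v \notin W.
    by apply/imsetP => -[x _ /eqP]; rewrite (negbTE (neq_lift _ _)).
  have := vR W; rewrite vW andbT (leq_trans (leq_imset_card _ _)) ?cardsT //=.
  move=> /existsP[M /andP[pM lM]].
  have [g [/(_ vW) gW gI gE]] := petals_star r1 uE pM lM.
  have fW x : lift v (f x) \in W by apply: imset_f.
  apply/containsP.
  exists (fun z => match z with inl x => lift v (f x) | inr y => g y end).
  split => [[x|x] [y|y] //|e].
  - by move=> /lift_inj /fI ->.
  - by move=> xy; have := gW y; rewrite -xy fW.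
  - by move=> xy; have := gW x; rewrite xy fW.
  - by move=> /gI ->.
  - move=> /setUP[] /imsetP[a aE ->]; rewrite -imset_comp; last exact: gE.
    by have := fE a aE; rewrite inE -imset_comp.
have /fin_all_exists [T TP] v : exists T : {set 'I_n.+1},
    [/\ v \notin T, #|T| <= c & {in E, forall e : {set _}, v \in e -> ~~ [disjoint e & T]}].
  have /negbT := poor v; rewrite negb_forall => /existsP[W].
  rewrite negb_imply => /andP[/andP[Wm vW] nM].
  have [[M pM lM]|[T [vT Tc TE]]] := petals_or_cover l r1 uE vW.
    by case/existsP: nM; exists M; rewrite pM.
  by exists T; split => //; apply: leq_trans Tc _; rewrite leq_add2r.
apply: leq_trans (leq_addr _ _).
apply: leq_trans (@card_bounded_link_covers _ E r c T r3 uE _ _ _) _;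
  try by move=> v; case: (TP v).
rewrite mulnA card_ord; apply: leq_trans gap _.
by have -> : (r - 2).+1 = r.-1 by lia.
Qed.

(** * Forbidding all the stars *)

(** The copy number 0 is split off and plays the role of the last star. *)
Lemma contains_copiesS k (G S : hypergraph) :
  contains (disjoint_union (disjoint_union G (copies k S)) S)
           (disjoint_union G (copies k.+1 S)).
Proof.
apply/containsP.
pose h (z : G + 'I_k.+1 * S) : (G + 'I_k * S) + S :=
  match z with
  | inl x => inl (inl x)
  | inr (i, y) => if unlift ord0 i is Some j then inl (inr (j, y)) else inr y
  end.
exists h; split.
  move=> [x|[i x]] [y|[j y]] /=.
  - by move=> [->].
  - by case: unliftP => // j' _.
  - by case: unliftP => // i' _.
  - by case: unliftP => [i'|] ->; case: unliftP => [j'|] -> // [*]; subst.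
move=> e /setUP[]/imsetP[a].
  move=> aG ->; rewrite -imset_comp (imset_comp inl inl); apply/setUP; left.
  by apply: imset_f; apply/setUP; left; apply: imset_f.
move=> /imset2P[i b _ bS ->] ->; rewrite -!imset_comp.
case: (unliftP ord0 i) => [j ij|i0].
  rewrite (@eq_imset _ _ _ (inl \o (inr \o pair j))); last first.
    by move=> x /=; rewrite ij liftK.
  rewrite imset_comp; apply/setUP; left; apply: imset_f; apply/setUP; right.
  by rewrite imset_comp; apply: imset_f; apply/imset2P; exists j b.
rewrite (@eq_imset _ _ _ inr); last by move=> x /=; rewrite i0 unlift_none.
by apply/setUP; right; apply: imset_f.
Qed.

Lemma contains_copies0 (G S : hypergraph) :
  contains G (disjoint_union G (copies 0 S)).
Proof.
apply/containsP.
pose h (z : G + 'I_0 * S) : G :=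
  match z with inl x => x | inr (i, _) => False_rect G (notF (valP i)) end.
exists h; split => [[x|[[]//]] [y|[[]//]] /= -> //|e /setUP[]/imsetP[a]].
  by move=> aG ->; rewrite -imset_comp imset_id.
by move=> /imset2P[[]].
Qed.

Lemma ex_copies_star_upper r l k (G : hypergraph) :
  2 < r -> exists N, forall n, N <= n ->
  ex r n [:: disjoint_union G (copies k (linear_star r l))]
    <= 'C(n, r) - 'C(n - k, r) + ex r (n - k) [:: G].
Proof.
move=> r3; elim: k => [|k [N IH]].
  exists 0 => n _; rewrite subn0 subnn add0n.
  exact/ex_le_contains/contains_copies0.
have [M MP] :=
  @ex_add_star r l (disjoint_union G (copies k (linear_star r l))) r3.
exists (maxn N M).+1 => -[//|n]; rewrite ltnS geq_max => /andP[/IH IHn /MP step].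
apply: leq_trans (ex_le_contains _ _ (contains_copiesS _ _ _)) _.
apply: leq_trans step _; rewrite subSS.
have -> : 'C(n.+1, r) = 'C(n, r) + 'C(n, r.-1).
  by case: r r3 {IH MP IHn} => // r _; rewrite binS.
have : 'C(n - k, r) <= 'C(n, r) by apply: leq_bin2l; lia.
lia.
Qed.

Theorem theorem1p3 (r l k : nat) (hr : 3 <= r) (hl : 4 <= l) :
  exists N : nat, forall n : nat, N <= n ->
    'C(n, r) - 'C(n - k, r)
      + ex r (n - k) [:: linear_path r l; linear_star r l]
      <= ex r n [:: disjoint_union (linear_path r l)
                                   (copies k (linear_star r l))]
    /\
    ex r n [:: disjoint_union (linear_path r l)
                              (copies k (linear_star r l))]
      <= 'C(n, r) - 'C(n - k, r) + ex r (n - k) [:: linear_path r l].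
Proof.
have [N NP] := @ex_copies_star_upper r l k (linear_path r l) hr.
have l0 : 0 < l by lia.
exists (maxn N k) => n; rewrite geq_max => /andP[nN kn]; split; last exact: NP.
apply: ex_copies_lower => //; apply/set0Pn.
  by exists (path_edge r (Ordinal l0)); apply: imset_f.
by exists (star_edge r (Ordinal l0)); apply: imset_f.
Qed.
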